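(* Let $r\ge 1$ be an integer and let $p$ be a (real) polynomial of degree at most $r$. Then $$\widetilde{T}_{n,r}(p,y)=p(y)\qquad\text{for all } y\in[c,d].$$
   Context: Setting. $[c,d]\subset\mathbb{R}$ is a compact interval, functions are real-valued, and $C^{r}[c,d]$ is the space of functions whose derivatives up to order $r$ exist and are continuous on $[c,d]$. Irregular grid. $c=z_0<z_1<\cdots<z_n=d$ is a partition with $0<d_1\le z_{k+1}-z_k\le d_2$ for $k=0,\dots,n-1$, where $d_2<2d_1$; here $d_1=\min_k(z_{k+1}-z_k)$ is the minimum mesh size. Activation. For $m>0$, $D(m)$ is the class of measurable functions $\eta:\mathbb{R}\to\mathbb{R}$ that are increasing (i.e. non-decreasing), with $\eta(y)=0$ for $y\le -m$, $\eta(y)=1$ for $y\ge m$, and $0<\eta(y)<1$ for $-m<y<m$. Fix $\eta\in D(m)$ and put $\sigma(y):=\eta(y+m)-\eta(y-m)$, $y\in\mathbb{R}$. Operator. For $g\in C^r[c,d]$ let $P_r(g;y,z_k):=\sum_{j=0}^{r}\frac{g^{(j)}(z_k)}{j!}(y-z_k)^j$ and $$\widetilde{T}_{n,r}(g,y):=\frac{\sum_{k=0}^{n}\sigma\!\left(\frac{2m}{d_1}(y-z_k)\right)P_r(g;y,z_k)}{\sum_{k=0}^{n}\sigma\!\left(\frac{2m}{d_1}(y-z_k)\right)},\qquad y\in[c,d].$$ *)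

(* Defs.v *)
From HB Require Import structures.
From mathcomp Require Import all_boot all_order all_algebra.
From mathcomp Require Import all_classical all_reals all_analysis.
Set Implicit Arguments.
Unset Strict Implicit.
Unset Printing Implicit Defensive.
Import Order.TTheory GRing.Theory Num.Theory.
Import numFieldNormedType.Exports.
Local Open Scope classical_set_scope.
Local Open Scope ring_scope.

(* Only the values z 0, ..., z n are nodes. The bound d1 must be attained, so
   it is the minimum mesh size. *)
Definition irregular_grid (R : realType) (c d : R) (n : nat) (z : nat -> R)
    (d1 d2 : R) : Prop :=
  [/\ (z 0%N = c) /\ (z n = d),
      forall k, (k < n)%N -> z k < z k.+1,
      forall k, (k < n)%N -> d1 <= z k.+1 - z k <= d2,
      exists2 k, (k < n)%N & d1 = z k.+1 - z k
    & 0 < d1 /\ d2 < 2 * d1].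

Definition activation_class (R : realType) (m : R) : set (R -> R) :=
  [set eta : R -> R |
    [/\ measurable_fun [set: R] eta,
        {homo eta : x y / x <= y},
        forall y, y <= - m -> eta y = 0,
        forall y, m <= y -> eta y = 1
      & forall y, - m < y < m -> 0 < eta y < 1]].

Definition bump_of (R : realType) (m : R) (eta : R -> R) (y : R) : R :=
  eta (y + m) - eta (y - m).

(* Derivative of a function on [c, d], one-sided at the end points; it depends
   only on the values of g on [c, d], whereas g^`() is two-sided at c and d. *)
Definition derive_on (R : realType) (c d : R) (g : R -> R) (x : R) : R :=
  lim ((g y - g x) / (y - x) @[y --> within `[c, d] x^']).

Definition derive_onn (R : realType) (c d : R) (j : nat) (g : R -> R) : R -> R :=
  iter j (derive_on c d) g.

Definition taylor_at (R : realType) (c d : R) (r : nat) (g : R -> R)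
    (y x : R) : R :=
  \sum_(j < r.+1) derive_onn c d j g x / (j`!)%:R * (y - x) ^+ j.

Definition interp_op (R : realType) (c d m : R) (eta : R -> R) (n : nat)
    (z : nat -> R) (d1 : R) (r : nat) (g : R -> R) (y : R) : R :=
  (\sum_(k < n.+1)
      bump_of m eta (2 * m / d1 * (y - z k)) * taylor_at c d r g y (z k))
  / (\sum_(k < n.+1) bump_of m eta (2 * m / d1 * (y - z k))).

(* Main.v *)
Require Import Defs.
From mathcomp Require Import all_boot all_order all_algebra.
From mathcomp Require Import all_classical all_reals all_analysis.
From mathcomp Require Import ring lra.
Import Order.TTheory GRing.Theory Num.Theory.
Import numFieldNormedType.Exports.
Local Open Scope classical_set_scope.
Local Open Scope ring_scope.

(* For a polynomial of degree at most r the Taylor polynomial P_r(p; ., z_k) is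
   p itself, so the operator multiplies p(y) by a quotient of equal sums.  That
   quotient is 1 because the weights are nonnegative and, the gaps being smaller
   than 2 * d1, some node lies within distance < d1 of y, where the weight is
   positive. *)

(** Properness makes limits along this filter unique, so the [lim] in [derive_on] can be computed
    from a convergence proof. *)
Lemma within_itv_dnbhs_proper (R : realType) (c d x : R) :
  c < d -> x \in `[c, d] -> ProperFilter (within `[c, d] x^').
Proof.
move=> cd; rewrite in_itv /= => /andP[cx xd].
apply: Build_ProperFilter_ex => A.
rewrite /within /dnbhs /= nearE /within /= => /nbhs_ballP[e /= e0 xeA].
(* There is room to the right of [x] unless [x = d], and then [c < d] leaves room to the left.
   Halving [e] keeps the witness strictly inside the ball. *)
have [xltd|dlex] := ltP x d.
  exists (x + Num.min (e / 2) (d - x)).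
  have m0 : 0 < Num.min (e / 2) (d - x) by rewrite lt_min; apply/andP; split; lra.
  have me : Num.min (e / 2) (d - x) <= e / 2 by rewrite ge_min lexx.
  have md : Num.min (e / 2) (d - x) <= d - x by rewrite ge_min lexx orbT.
  apply: xeA.
  - by rewrite /ball /= opprD addNKr normrN gtr0_norm //; lra.
  - by rewrite gt_eqF // ltrDl.
  - by rewrite /= in_itv /=; apply/andP; split; lra.
exists (x - Num.min (e / 2) (x - c)).
have m0 : 0 < Num.min (e / 2) (x - c) by rewrite lt_min; apply/andP; split; lra.
have me : Num.min (e / 2) (x - c) <= e / 2 by rewrite ge_min lexx.
have mc : Num.min (e / 2) (x - c) <= x - c by rewrite ge_min lexx orbT.
apply: xeA.
- by rewrite /ball /= opprB addrC subrK gtr0_norm //; lra.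
- by rewrite lt_eqF // ltrBlDr ltrDl.
- by rewrite /= in_itv /=; apply/andP; split; lra.
Qed.

Lemma derive_on_horner (R : realType) (c d : R) (g : R -> R) (q : {poly R}) :
  c < d -> {in `[c, d], g =1 horner q} ->
  {in `[c, d], derive_on c d g =1 horner q^`()}.
Proof.
move=> cd gq x xcd.
have pF := @within_itv_dnbhs_proper _ _ _ _ cd xcd.
have /factor_theorem[s qE] : root (q - q.[x]%:P) x.
  by rewrite /root !hornerE subrr.
have -> : q^`().[x] = s.[x].
  have -> : q = s * ('X - x%:P) + q.[x]%:P by rewrite -qE subrK.
  by rewrite derivD derivM derivXsubC derivC !hornerE subrr; ring.
apply: cvg_lim => //.
have s_cvg : s.[y] @[y --> within `[c, d] x^'] --> s.[x].
  by do 2 apply: cvg_within_filter; exact: continuous_horner.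
apply: cvg_trans s_cvg; apply: near_eq_cvg.
rewrite /within /dnbhs /= nearE /within /=.
apply: (@filterE _ (nbhs x)) => y /= yx ycd.
rewrite !gq //.
have /(congr1 (horner^~ y)) := qE; rewrite !hornerE => ->.
by rewrite mulfK // subr_eq0.
Qed.

Lemma derive_onn_horner (R : realType) (c d : R) (p : {poly R}) (j : nat) :
  c < d -> {in `[c, d], derive_onn c d j (horner p) =1 horner p^`(j)}.
Proof.
move=> cd; elim: j => [|j IHj] // x xcd.
by rewrite derivnS; exact: (@derive_on_horner _ _ _ _ _ cd IHj).
Qed.

Lemma taylor_at_horner (R : realType) (c d : R) (r : nat) (p : {poly R})
    (y x : R) :
  c < d -> (size p <= r.+1)%N -> x \in `[c, d] ->
  taylor_at c d r (horner p) y x = p.[y].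
Proof.
move=> cd sp xcd.
(* Expand [p] at [x + (y - x)]; the coefficients are the normalized derivatives
   [p^]N(j)[, and]p^[(j)] is [j!] times these. *)
rewrite -[in RHS](subrK x y) [y - x + x]addrC.
rewrite (nderiv_taylor_wide _ sp); last exact: mulrC.
apply: eq_bigr => j _; congr (_ * _).
by rewrite derive_onn_horner // nderivn_def hornerMn -mulr_natr mulfK //.
Qed.

Lemma bump_of_ge0 (R : realType) (m : R) (eta : R -> R) (t : R) :
  0 < m -> activation_class m eta -> 0 <= bump_of m eta t.
Proof. by move=> m0 [_ mono _ _ _]; rewrite subr_ge0; apply: mono; lra. Qed.

Lemma bump_of_gt0 (R : realType) (m : R) (eta : R -> R) (t : R) :
  0 < m -> activation_class m eta -> `|t| < 2 * m -> 0 < bump_of m eta t.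
Proof.
move=> m0 [_ _ eta0 eta1 etaI]; rewrite ltr_norml /bump_of => /andP[tl tr].
(* For [0 <= t] the first term of the bump is 1 and the second is below 1; for [t < 0] the second is
   0 and the first is positive. *)
have [t0|t0] := leP 0 t.
  rewrite (eta1 (t + m)); last by lra.
  have [tm|tm] := leP (t - m) (- m); first by rewrite (eta0 (t - m)) //; lra.
  have /andP[_ +] : 0 < eta (t - m) < 1 by apply: etaI; apply/andP; split; lra.
  by rewrite subr_gt0.
rewrite (eta0 (t - m)); last by lra.
have /andP[+ _] : 0 < eta (t + m) < 1 by apply: etaI; apply/andP; split; lra.
by rewrite subr0.
Qed.

Lemma irregular_grid_le (R : realType) (c d : R) (n : nat) (z : nat -> R)
    (d1 d2 : R) (i j : nat) :
  irregular_grid c d n z d1 d2 -> (i <= j <= n)%N -> z i <= z j.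
Proof.
move=> [_ zlt _ _ _]; elim: j => [|j IHj] /andP[].
  by rewrite leqn0 => /eqP ->.
rewrite leq_eqVlt => /predU1P[-> //|ij jn].
by apply: le_trans (IHj _) (ltW (zlt _ jn)); rewrite -ltnS ij ltnW.
Qed.

Lemma irregular_grid_near_node (R : realType) (c d : R) (n : nat)
    (z : nat -> R) (d1 d2 y : R) :
  irregular_grid c d n z d1 d2 -> y \in `[c, d] ->
  exists2 k, (k <= n)%N & `|y - z k| < d1.
Proof.
move=> [[z0 zn] _ gap _ [d10 d21]]; rewrite in_itv /= => /andP[cy yd].
(* Induction on [i] locates the cell containing [y]; in the base case [y = z 0]. *)
suff H i : (i <= n)%N -> y <= z i -> exists2 k, (k <= n)%N & `|y - z k| < d1.
  by apply: (H n) => //; rewrite zn.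
elim: i => [_ yz|i IHi ilt yz].
  by exists 0%N => //; rewrite ltr_norml; apply/andP; split; lra.
have [yzi|ziy] := leP y (z i); first by apply: IHi => //; exact: ltnW.
have /andP[_ gapi] := gap _ ilt.
(* If [y] is at least [d1] past [z i], its distance to [z i.+1] is at most [d2 - d1 < d1]. *)
have [yl|yr] := ltP (y - z i) d1.
  by exists i; [exact: ltnW | rewrite ltr_norml; apply/andP; split; lra].
by exists i.+1 => //; rewrite ltr_norml; apply/andP; split; lra.
Qed.

Lemma bump_of_sum_gt0 (R : realType) (c d : R) (n : nat) (z : nat -> R)
    (d1 d2 m : R) (eta : R -> R) (y : R) :
  irregular_grid c d n z d1 d2 -> 0 < m -> activation_class m eta ->
  y \in `[c, d] ->
  0 < \sum_(k < n.+1) bump_of m eta (2 * m / d1 * (y - z k)).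
Proof.
move=> hgrid m0 heta ycd.
have d10 : 0 < d1 by case: hgrid => _ _ _ _ [].
have [k kn yk] := @irregular_grid_near_node _ _ _ _ _ _ _ _ hgrid ycd.
rewrite (bigD1 (Ordinal (kn : (k < n.+1)%N))) //=.
apply: ltr_pwDl; last by apply: sumr_ge0 => i _; exact: bump_of_ge0.
apply: bump_of_gt0 => //.
have md0 : 0 < 2 * m / d1 by rewrite divr_gt0 // mulr_gt0.
(* The scale [2 * m / d1] turns distance below [d1] into an argument below [2 * m]. *)
by rewrite normrM gtr0_norm // mulrAC ltr_pdivrMr // ltr_pM2l // mulr_gt0.
Qed.

Theorem proposition2p5 (R : realType) (c d : R) (n : nat) (z : nat -> R)
    (d1 d2 : R) (hgrid : irregular_grid c d n z d1 d2)
    (m : R) (hm : 0 < m) (eta : R -> R) (heta : activation_class m eta)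
    (r : nat) (hr : (1 <= r)%N) (p : {poly R}) (hp : (size p <= r.+1)%N) :
  forall y : R, y \in `[c, d] -> interp_op c d m eta n z d1 r (horner p) y = p.[y].
Proof.
move=> y ycd; have w0 := @bump_of_sum_gt0 _ _ _ _ _ _ _ _ _ _ hgrid hm heta ycd.
have [[z0 zn] zlt _ [k0 k0n _] _] := hgrid.
have zle i j := @irregular_grid_le _ _ _ _ _ _ _ i j hgrid.
(* The cell [k0] attaining the minimum mesh shows that the grid has at least one cell, so the
   interval is nondegenerate. *)
have cd : c < d.
  rewrite -z0 -zn (le_lt_trans (zle 0%N k0 _)) ?(ltnW k0n) //.
  by rewrite (lt_le_trans (zlt _ k0n)) // zle // k0n leqnn.
rewrite /interp_op.
under eq_bigr => k _.
  rewrite taylor_at_horner //; last first.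
    have kn : (k <= n)%N := ltn_ord k.
    by rewrite in_itv /= -z0 -zn !zle ?kn ?leqnn.
  over.
by rewrite -mulr_suml mulrC mulKf ?gt_eqF.
Qed.
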